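(* Let $G$ be a countable group and let $H<L<N_G(H)$ be subgroups of $G$ such that the triple $(G,H,L)$ is right amenable. Then every right Følner sequence $(F_n)$ for $(G,H,L)$ is a strong sequence for $(G,H,L)$; that is, for every unitary representation $(\mathcal{H},\pi)$ of $G$ and every $v\in\mathcal{H}^H$, $$\lim_n\frac{1}{|F_n|}\sum_{s\in F_n}\pi(s)v=P_Lv$$ in the norm topology on $\mathcal{H}$.
   Context: $N_G(H)$ is the normalizer of $H$ in $G$. For a unitary representation $(\mathcal{H},\pi)$ of $G$ and a subgroup $M<G$, $\mathcal{H}^M$ is the closed subspace of $\pi(M)$-invariant vectors and $P_M$ is the orthogonal projection onto $\mathcal{H}^M$. For $v\in\mathcal{H}^H$ and $s=gH\in G/H$, $\pi(s)v:=\pi(g)v$ is well defined. $N_G(H)$ acts on $G/H$ by $c_H(s)xH=xs^{-1}H$, $s\in N_G(H)$. For $H<L<N_G(H)$, a sequence $(F_n)$ of (nonempty) finite subsets of $L/H$ is a right Følner sequence for $(G,H,L)$ if $\lim_n |F_n\triangle c_H(s)F_n|/|F_n|=0$ for all $s\in L$. The triple $(G,H,L)$ is right amenable if it admits a right Følner sequence $(F_n)$ with $|F_n|\to\infty$. *)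

(* Defs.v *)
From HB Require Import structures.
From mathcomp Require Import all_boot all_order all_algebra sesquilinear finmap.
From mathcomp Require Import complex.
From mathcomp Require Import all_classical all_reals all_analysis.

Set Implicit Arguments.
Unset Strict Implicit.
Unset Printing Implicit Defensive.

Import Order.TTheory GRing.Theory Num.Theory.
Import numFieldNormedType.Exports.

Local Open Scope classical_set_scope.
Local Open Scope ring_scope.

(* Complex Hilbert spaces: the inner product is linear in its first argument
   and conjugate-linear in the second. *)
HB.mixin Record NormedModule_isHilbert (R : realType) V
    of CompleteNormedModule R[i] V := {
  hdot : {dot V for (@Num.conj R[i])};
  hdot_norm : forall u : V, hdot u u = `|u| ^+ 2
}.

#[short(type="hilbertType")]
HB.structure Definition Hilbert (R : realType) :=
  {V of NormedModule_isHilbert R V & CompleteNormedModule R[i] V}.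

(* Each operator is invertible, hence unitary, by the two homomorphism laws. *)
Record unitary_rep (R : realType) (G : groupType) (V : hilbertType R) :=
  UnitaryRep {
    rep_op :> G -> {linear V -> V};
    rep_op1 : forall v, rep_op 1%g v = v;
    rep_opM : forall g h v, rep_op (g * h)%g v = rep_op g (rep_op h v);
    rep_op_dot : forall g u v, hdot (rep_op g u) (rep_op g v) = hdot u v
  }.

Definition fixed_vectors (R : realType) (G : groupType) (V : hilbertType R)
    (pi : unitary_rep G V) (M : groupClosed G) : set V :=
  [set v | forall g, g \in M -> pi g v = v].

(* The orthogonal projection onto [W], a total function that takes the junk
   value 0 at a vector without a projection (this does not happen when [W] is
   a closed subspace). *)
Definition orth_proj (R : realType) (V : hilbertType R) (W : set V) (v : V) : V :=
  xget 0 [set p | W p /\ forall w, W w -> hdot (v - p) w = 0].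

Section Cosets.
Context {G : groupType}.
Implicit Types (H L : groupClosed G) (g x s : G) (A : set G).

Definition normalizer H : set G :=
  [set g | [set (g * x * g^-1)%g | x in [set` H]] = [set` H]].

Definition lcoset H g : set G := [set (g * x)%g | x in [set` H]].

Definition lcosets H L : set (set G) := [set lcoset H g | g in [set` L]].

Definition coset_rep A : G := xget 1%g A.

(* [c_H(s)], the action of the normalizer on cosets; see [coset_actE]. *)
Definition coset_act H s A : set G := lcoset H (coset_rep A * s^-1)%g.

Definition fset_symdiff (A B : {fset set G}) : {fset set G} :=
  ((A `\` B) `|` (B `\` A))%fset.

Definition right_folner (R : realType) H L (F : nat -> {fset set G}) : Prop :=
  [/\ forall n, F n != fset0,
      forall n, [set` F n] `<=` lcosets H L &
      forall s, s \in L ->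
        (fun n => #|` fset_symdiff (F n) (coset_act H s @` F n)%fset|%:R
                  / #|` F n|%:R : R) @ \oo --> (0 : R)].

Definition right_amenable (R : realType) H L : Prop :=
  exists2 F : nat -> {fset set G},
    right_folner R H L F & (fun n => #|` F n|) @ \oo --> \oo.

(* [pi(s) v] for a coset [s] and an [H]-invariant [v]; see [rep_cosetE]. *)
Definition rep_coset (R : realType) (V : hilbertType R)
  (pi : unitary_rep G V) (s : set G) (v : V) : V := pi (coset_rep s) v.

Definition strong_sequence (R : realType) H L (F : nat -> {fset set G}) : Prop :=
  forall (V : hilbertType R) (pi : unitary_rep G V) (v : V),
    fixed_vectors pi H v ->
    (fun n => (#|` F n|%:R : R[i])^-1 *: \sum_(s <- F n) rep_coset pi s v)
      @ \oo --> orth_proj (fixed_vectors pi L) v.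

Lemma coset_rep_lcoset H g : lcoset H g (coset_rep (lcoset H g)).
Proof.
rewrite /coset_rep; apply: xgetPex; exists g, 1%g; rewrite ?mulg1 /=; last by [].
exact: gpred1.
Qed.

Lemma lcosetMr H g h : h \in H -> lcoset H (g * h)%g = lcoset H g.
Proof.
move=> hH; apply/seteqP; split=> _ [x /= xH <-].
  by exists (h * x)%g; rewrite ?mulgA//=; apply: gpredM.
exists (h^-1 * x)%g; last by rewrite mulgA mulgK.
by apply: gpredM => //; apply: gpredVr.
Qed.

Lemma coset_actE H s x : normalizer H s ->
  coset_act H s (lcoset H x) = lcoset H (x * s^-1)%g.
Proof.
move=> Ns; rewrite /coset_act.
have [h /= hH <-] := coset_rep_lcoset H x.
have : [set` H] (s * h * s^-1)%g by rewrite -Ns; exists h.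
by move=> /= /(lcosetMr (x * s^-1)%g) <-; rewrite !mulgA mulgVK.
Qed.

Lemma rep_cosetE (R : realType) (V : hilbertType R) (pi : unitary_rep G V) H g v :
  fixed_vectors pi H v -> rep_coset pi (lcoset H g) v = pi g v.
Proof.
move=> vH; rewrite /rep_coset.
by have [h /= hH <-] := coset_rep_lcoset H g; rewrite rep_opM vH.
Qed.

End Cosets.

Lemma orth_proj_eq (R : realType) (V : hilbertType R) (W : set V) (v p : V) :
  (forall x y, W x -> W y -> W (x - y)) ->
  W p -> (forall w, W w -> hdot (v - p) w = 0) -> orth_proj W v = p.
Proof.
move=> WB Wp op; apply: xget_unique => // q [Wq oq].
apply/eqP; rewrite -subr_eq0; apply/negPn/negP => nz.
have := @neq0_dnorm_gt0 _ _ _ (@hdot R V) _ nz.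
suff -> : hdot (q - p) (q - p) = 0 by rewrite ltxx.
have -> : hdot (q - p) = hdot ((v - p) - (v - q)) :> (V -> R[i]).
  by rewrite [in RHS]opprB [in RHS]addrC subrKA.
by rewrite linearBl /= op ?oq ?subrr//; exact: WB.
Qed.

(* Main.v *)
(* The vectors [w] of [V^H] whose averages over [F n] tend to 0 form a closed
   subspace [N], because averaging is a contraction. The Folner condition puts
   [pi s w - w] in [N] for [s] in [L] and [w] in [V^H]. Decompose [v = q + p]
   with [q] in [N] and [p] orthogonal to [N]. Then [p] is orthogonal to
   [pi s p - p] for every [s] in [L], which forces [pi s p = p]: the averages
   of [v] tend to [p]. Pairing with an [L]-invariant vector is unchanged by
   averaging, so [N] is orthogonal to [V^L] and [p] is the projection of [v]. *)
Require Import Defs.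
From mathcomp Require Import all_boot all_order all_algebra finmap.
From mathcomp Require Import sesquilinear complex.
From mathcomp Require Import all_classical all_reals all_analysis.
From mathcomp Require Import ring.

Set Implicit Arguments.
Unset Strict Implicit.
Unset Printing Implicit Defensive.

Import Order.TTheory GRing.Theory Num.Theory.
Import numFieldNormedType.Exports.

Local Open Scope classical_set_scope.
Local Open Scope ring_scope.

(** * Inner product geometry and orthogonal projection in a Hilbert space *)

Section HilbertSpace.
Context {R : realType} {V : hilbertType R}.
Implicit Types (u v w x y : V) (W : set V).

Lemma hdotC u v : hdot u v = (hdot v u)^*.
Proof. by rewrite hermC/= expr0 mul1r. Qed.

(* The loss of squared norm when subtracting the component of [x] along [u],
   with denominators cleared so that [u = 0] is allowed. *)
Lemma norm_sub_component x u :
  `|x - (hdot x u / `|u| ^+ 2) *: u| ^+ 2 * `|u| ^+ 2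
  = `|x| ^+ 2 * `|u| ^+ 2 - `|hdot x u| ^+ 2.
Proof.
have [->|u0] := eqVneq u 0.
  by rewrite linear0r !normr0 expr0n /= !mulr0 subr0.
have N0 : `|u| ^+ 2 != 0 by rewrite expf_neq0 ?normr_eq0.
have NC : (`|u| ^+ 2)^* = `|u| ^+ 2 by rewrite geC0_conj ?exprn_ge0.
set h := hdot x u; set c := h / _.
rewrite -(hdot_norm (x - _)) dnormB !hdot_norm normrZ (linearZr_LR (@hdot R V)) /= -/h.
have cC : c^* = h^* / `|u| ^+ 2 by rewrite rmorphM /= fmorphV /= NC.
rewrite cC !rmorphM /= fmorphV /= NC conjCK exprMn normCK cC /c normCK.
by field; rewrite normr_eq0.
Qed.

(** Cauchy-Schwarz: the difference of the squares is the left side of [norm_sub_component], a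
    product of two squares of norms. *)
Lemma hdot_le u v : `|hdot u v| <= `|u| * `|v|.
Proof.
rewrite -(@ler_pXn2r _ 2) ?nnegrE ?mulr_ge0// exprMn -subr_ge0.
by rewrite -norm_sub_component mulr_ge0 ?exprn_ge0.
Qed.

Lemma parallelogram u v :
  `|u + v| ^+ 2 + `|u - v| ^+ 2 = 2 * `|u| ^+ 2 + 2 * `|v| ^+ 2.
Proof. by rewrite -!hdot_norm dnormB dnormD; ring. Qed.

(** The order on [R[i]] is only partial, so the infimum is taken in [R], over real parts, and then
    embedded back. *)
Lemma sqr_dist_inf W v : W !=set0 ->
  exists d : R[i], (forall w, W w -> d <= `|v - w| ^+ 2) /\
    forall e, 0 < e -> exists2 w, W w & `|v - w| ^+ 2 < d + e.
Proof.
move=> [w0 Ww0].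
pose r w := complex.Re (`|v - w| ^+ 2).
have rE w : (r w)%:C%C = `|v - w| ^+ 2 by rewrite RRe_real// ger0_real// exprn_ge0.
have r0 w : 0 <= r w by rewrite -lecR rE exprn_ge0.
have lb : has_lbound (r @` W) by exists 0 => _ [w _ <-].
exists (inf (r @` W))%:C%C; split=> [w Ww|e e0].
  by rewrite -rE lecR ge_inf//; exists w.
have eE : (complex.Re e)%:C%C = e by rewrite RRe_real// gtr0_real.
have [||_ [w Ww <-] lt_w] := @inf_adherent R (r @` W) (complex.Re e).
- by rewrite -ltcR eE.
- by split=> //; exists (r w0), w0.
by exists w; rewrite // -rE -eE -rmorphD ltcR.
Qed.

(** The midpoint of [x] and [y] lies in [W], so its squared distance to [v] is at least [d]; the
    parallelogram law for [v - x] and [v - y] then bounds [x - y]. This makes near minimizers a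
    Cauchy family. *)
Lemma near_minimizer_dist W v (d e : R[i]) x y :
  (forall a u w, W u -> W w -> W (a *: u + w)) ->
  (forall w, W w -> d <= `|v - w| ^+ 2) -> W x -> W y ->
  `|v - x| ^+ 2 < d + e -> `|v - y| ^+ 2 < d + e ->
  `|x - y| ^+ 2 < 2 ^+ 2 * e.
Proof.
move=> Wlin dW Wx Wy ltx lty.
have mid : W (2^-1 *: x + 2^-1 *: y).
  apply: (Wlin) => //.
  (* This form fits the closure hypothesis, whose second vector carries no coefficient. *)
  have -> : 2^-1 *: y = (- 2^-1) *: y + y; last exact: Wlin.
  by rewrite -[in RHS](scale1r y) scalerA -scalerDl; congr (_ *: _); field.
have := parallelogram (v - x) (v - y).
have -> : v - x - (v - y) = y - x by rewrite opprB addrC addrA subrK addrC.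
have -> : v - x + (v - y) = 2 *: (v - (2^-1 *: x + 2^-1 *: y)).
  rewrite scalerBr scalerDr !scalerA !mulfV ?pnatr_eq0// !scale1r.
  by rewrite -[2]/(2%:R) scaler_nat mulr2n opprD addrACA.
rewrite normrZ exprMn gtr0_norm// (distrC y x) => eq1.
have -> : `|x - y| ^+ 2 = 2 * `|v - x| ^+ 2 + 2 * `|v - y| ^+ 2
  - 2 ^+ 2 * `|v - (2^-1 *: x + 2^-1 *: y)| ^+ 2 by rewrite -eq1; ring.
have m := dW _ mid.
have -> : 2 ^+ 2 * e = 2 * (d + e) + 2 * (d + e) - 2 ^+ 2 * d by ring.
apply: ltr_leB; last by rewrite ler_pM2l// exprn_gt0.
by rewrite ltrD// ltr_pM2l.
Qed.

(** Moving [x] within [W] along [u] cannot bring the squared distance below [d], so removing the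
    component of [v - x] along [u] loses less than [e ^+ 2]; [norm_sub_component] expresses this
    loss through [hdot (v - x) u]. *)
Lemma near_minimizer_hdot W v (d e : R[i]) x u :
  (forall a u w, W u -> W w -> W (a *: u + w)) ->
  (forall w, W w -> d <= `|v - w| ^+ 2) -> W x -> W u -> 0 <= e ->
  `|v - x| ^+ 2 < d + e ^+ 2 -> `|hdot (v - x) u| <= e * `|u|.
Proof.
move=> Wlin dW Wx Wu e0 ltx.
rewrite -(@ler_pXn2r _ 2) ?nnegrE ?mulr_ge0// exprMn.
have := norm_sub_component (v - x) u; set c := _ / _ => eq1.
have -> : `|hdot (v - x) u| ^+ 2
    = (`|v - x| ^+ 2 - `|v - x - c *: u| ^+ 2) * `|u| ^+ 2.
  by rewrite mulrBl eq1; ring.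
apply: ler_wpM2r; first exact: exprn_ge0.
rewrite lerBlDl; apply/ltW/(lt_le_trans ltx); rewrite lerD2r.
by rewrite -addrA -opprD (addrC x); apply/dW/Wlin.
Qed.

(* Completeness is applied to the filter generated by the sets [B e] of points
   of [W] that nearly minimize the squared distance to [v]. *)
Theorem hilbert_projection W v :
  W 0 -> (forall a u w, W u -> W w -> W (a *: u + w)) -> closed W ->
  exists2 p, W p & forall w, W w -> hdot (v - p) w = 0.
Proof.
move=> W0 Wlin Wc.
have [d [dW dinf]] := @sqr_dist_inf W v (ex_intro _ 0 W0).
pose B (e : R[i]) := [set w | W w /\ `|v - w| ^+ 2 < d + e ^+ 2].
have BI (e e' : R[i]) : 0 < e -> 0 < e' -> e <= e' -> B e `<=` B e'.
  move=> e0 e'0 le w [Ww lw]; split=> //; apply: (lt_le_trans lw).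
  by rewrite lerD2l ler_pXn2r// nnegrE ltW.
have FF : Filter (filter_from [set e : R[i] | 0 < e] B).
  apply: filter_from_filter; first by exists 1 => /=.
  move=> i j /= i0 j0.
  (* Positive elements of [R[i]] are real, hence comparable. *)
  have /orP[le|le] : (i <= j) || (j <= i).
    exact: real_leVge (gtr0_real i0) (gtr0_real j0).
  - by exists i => // w wi; split=> //; apply: BI wi.
  - by exists j => // w wi; split=> //; apply: BI wi.
have FP : ProperFilter (filter_from [set e : R[i] | 0 < e] B).
  apply: filter_from_proper => e /= e0.
  by have [w Ww lw] := dinf (e ^+ 2) (exprn_gt0 _ e0); exists w.
have FB (e : R[i]) : 0 < e -> filter_from [set e : R[i] | 0 < e] B (B e).
  by move=> e0; exists e.
have dist_lt (e : R[i]) x y : 0 < e -> B e x -> B e y -> `|x - y| < 2 * e.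
  move=> e0 [Wx lx] [Wy ly].
  rewrite -(@ltr_pXn2r _ 2) ?nnegrE ?mulr_ge0// ?(ltW e0)// exprMn.
  exact: (near_minimizer_dist Wlin dW Wx Wy lx ly).
have /cauchy_cvg/cvg_ex[/= p Fp] : cauchy (filter_from [set e : R[i] | 0 < e] B).
  apply: cauchy_exP => e e0.
  have e20 : 0 < e / 2 by rewrite divr_gt0.
  have [x Bx] := filter_ex (FB _ e20).
  exists x, (e / 2) => // y By; rewrite -ball_normE /=.
  by rewrite (lt_le_trans (dist_lt _ _ _ e20 Bx By))// mulrC divfK// pnatr_eq0.
have approx (e : R[i]) : 0 < e -> exists2 w, B e w & `|p - w| < e.
  move=> e0; have Fb : nbhs p (ball p e) by exact: nbhsx_ballx.
  have [w [bw Bw]] := filter_ex (filterI (Fp _ Fb) (FB _ e0)).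
  by exists w => //; rewrite -ball_normE in bw.
exists p => [|u Wu].
  apply: Wc => A /nbhs_ballP[e e0 bA].
  by have [w [Ww _] pw] := approx e e0; exists w; split=> //; apply: bA; rewrite -ball_normE.
apply/eqP; rewrite -normr_eq0 eq_le normr_ge0 andbT; apply/ler_addgt0Pr => e e0.
rewrite add0r.
(* The factor 2 shares [e] between two error terms; the added 1 keeps the divisor positive when
   [u = 0]. *)
have k0 : 0 < 2 * (`|u| + 1) by rewrite mulr_gt0// ltr_wpDl.
have d0 : 0 < e / (2 * (`|u| + 1)) by rewrite divr_gt0.
have [w [Ww lw] pw] := approx _ d0.
(* The first difference is nearly orthogonal to [u] because [w] nearly minimizes; the second is
   small in norm. *)
have -> : v - p = (v - w) - (p - w) by rewrite opprB addrA subrK.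
rewrite linearBl; apply: (le_trans (ler_normB _ _)).
apply: (@le_trans _ _ (e / (2 * (`|u| + 1)) * `|u| + e / (2 * (`|u| + 1)) * `|u|)).
  apply: lerD; first by apply: (near_minimizer_hdot Wlin dW) => //; exact: ltW.
  by apply: (le_trans (hdot_le _ _)); rewrite ler_wpM2r// ltW.
have -> : e / (2 * (`|u| + 1)) * `|u| + e / (2 * (`|u| + 1)) * `|u|
    = e * (`|u| / (`|u| + 1)) by field; rewrite gt_eqF// ltr_wpDl.
by rewrite ger_pMr// ler_pdivrMr ?mul1r ?lerDl// ltr_wpDl.
Qed.

Lemma closure_dist (W : set V) p (e : R[i]) :
  closure W p -> 0 < e -> exists2 w, W w & `|p - w| < e.
Proof.
move=> /(_ (ball p e)) cp e0; have [w [Ww]] := cp (nbhsx_ballx _ _ e0).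
by rewrite -ball_normE; exists w.
Qed.

End HilbertSpace.

(** * Fixed vectors, coset averages and null vectors of a unitary representation *)

Section UnitaryRepresentation.
Context {R : realType} {G : groupType} {V : hilbertType R}.
Variable pi : unitary_rep G V.
Implicit Types (g s : G) (H L M : groupClosed G) (u v w : V) (A B : {fset set G}).

Lemma rep_norm g v : `|pi g v| = `|v|.
Proof.
by apply/eqP; rewrite -(@eqrXn2 _ 2)// -!hdot_norm rep_op_dot.
Qed.

Lemma rep_dotV g u v : hdot (pi g u) v = hdot u (pi g^-1%g v).
Proof. by rewrite -(rep_op_dot pi g u) -rep_opM mulgV rep_op1. Qed.

Lemma fixed_vectors_lin M a u w :
  fixed_vectors pi M u -> fixed_vectors pi M w -> fixed_vectors pi M (a *: u + w).
Proof. by move=> uM wM g gM; rewrite linearP uM// wM. Qed.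

Lemma fixed_vectorsB M u w :
  fixed_vectors pi M u -> fixed_vectors pi M w -> fixed_vectors pi M (u - w).
Proof. by move=> uM wM g gM; rewrite linearB/= uM// wM. Qed.

(** A fixed [w] near [p] cancels in [pi g p - p], leaving [pi g (p - w) - (p - w)], which is small
    because [pi g] is isometric. *)
Lemma closed_fixed_vectors M : closed (fixed_vectors pi M).
Proof.
move=> p cp g gM; apply/eqP; rewrite -subr_eq0 -normr_eq0 eq_le normr_ge0 andbT.
apply/ler_addgt0Pr => e e0; rewrite add0r.
have [w wM pw] := closure_dist cp (divr_gt0 e0 (ltr0Sn _ 1)).
have -> : pi g p - p = pi g (p - w) - (p - w).
  by rewrite linearB /= wM// opprB addrA subrK.
rewrite (le_trans (ler_normB _ _))// rep_norm [leRHS]splitr.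
by rewrite lerD// ltW.
Qed.

Lemma fixed_vectors_normalizer H s v :
  normalizer H s -> fixed_vectors pi H v -> fixed_vectors pi H (pi s v).
Proof.
move=> Ns vH h hH; have : [set` H] h by [].
rewrite -Ns => -[x /= xH <-].
by rewrite -rep_opM mulgVK rep_opM vH.
Qed.

(** Chosen representatives make this linear in [v] on all of [V]; it is independent of the choice
    when [v] is [H]-fixed and [A] consists of cosets of [H]. *)
Definition coset_mean A v : V :=
  (#|` A|%:R : R[i])^-1 *: \sum_(s <- A) rep_coset pi s v.

Lemma coset_mean_lin A a u w :
  coset_mean A (a *: u + w) = a *: coset_mean A u + coset_mean A w.
Proof.
rewrite /coset_mean scalerA mulrC -scalerA -scalerDr [a *: \sum_(_ <- _) _]scaler_sumr -big_split /=.
by congr (_ *: _); apply: eq_bigr => s _; rewrite /rep_coset linearP.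
Qed.

Lemma coset_meanB A u w : coset_mean A (u - w) = coset_mean A u - coset_mean A w.
Proof. by rewrite addrC -scaleN1r coset_mean_lin scaleN1r addrC. Qed.

Lemma coset_mean_norm A v : `|coset_mean A v| <= `|v|.
Proof.
rewrite /coset_mean normrZ normfV normr_nat.
(* The inverse of 0 is 0, so the mean over the empty set vanishes. *)
have [->|A0] := eqVneq #|` A| 0%N; first by rewrite invr0 mul0r.
rewrite mulrC ler_pdivrMr ?ltr0n ?lt0n//.
apply: (le_trans (ler_norm_sum _ _ _)).
under eq_bigr do rewrite rep_norm.
by rewrite big_const_seq count_predT iter_addr_0 mulr_natr.
Qed.

Lemma coset_mean_fixed L H A v : A != fset0 -> [set` A] `<=` lcosets H L ->
  {subset H <= L} -> fixed_vectors pi L v -> coset_mean A v = v.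
Proof.
move=> A0 AL HL vL; have vH : fixed_vectors pi H v by move=> g /HL; exact: vL.
rewrite /coset_mean (eq_big_seq (fun=> v)) => [|s sA].
  rewrite big_const_seq count_predT iter_addr_0 -[v *+ _]scaler_nat scalerA mulVf ?scale1r//.
  by rewrite pnatr_eq0 cardfs_eq0.
by have [g gL <-] := AL _ sA; rewrite rep_cosetE// vL.
Qed.

(** Each [pi g] with [g] in [L] passes to the other side as [pi g^-1], which fixes [v]. *)
Lemma coset_mean_dot L H A u v : A != fset0 -> [set` A] `<=` lcosets H L ->
  fixed_vectors pi H u -> fixed_vectors pi L v ->
  hdot (coset_mean A u) v = hdot u v.
Proof.
move=> A0 AL uH vL; rewrite /coset_mean (linearZl_LR (@hdot R V)) /=.
rewrite (linear_sumlz (@hdot R V)) /=.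
rewrite (eq_big_seq (fun=> hdot u v)) => [|s sA].
  rewrite big_const_seq count_predT iter_addr_0 -[hdot u v *+ _]mulr_natl mulrA mulVf ?mul1r//.
  by rewrite pnatr_eq0 cardfs_eq0.
have [g gL <-] := AL _ sA; rewrite rep_cosetE// (rep_dotV g u) vL//.
exact: gpredVr.
Qed.

(** The terms over the intersection cancel; what is left runs over two disjoint differences. *)
Lemma sum_fset_symdiff A B (f : set G -> V) (c : R[i]) :
  (forall t, `|f t| <= c) ->
  `|\sum_(s <- A) f s - \sum_(s <- B) f s| <= #|` fset_symdiff A B|%:R * c.
Proof.
move=> fc.
have sumID (X Y : {fset set G}) :
  \sum_(s <- X) f s = 
    \sum_(s <- (X `&` Y)%fset) f s + \sum_(s <- (X `\` Y)%fset) f s.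
  rewrite (big_fsetID _ (mem Y)) /=; congr (_ + _); congr bigop.
    by apply/congr1/fsetP => t; rewrite !inE.
  by apply/congr1/fsetP => t; rewrite !inE andbC.
have sum_le (X : {fset set G}) : `|\sum_(s <- X) f s| <= #|` X|%:R * c.
  apply: (le_trans (ler_norm_sum _ _ _)).
  apply: (@le_trans _ _ (\sum_(t <- X) c)); first exact: ler_sum.
  by rewrite big_const_seq count_predT iter_addr_0 mulr_natl.
rewrite (sumID A B) (sumID B A) fsetIC opprD addrACA subrr add0r.
apply: (le_trans (ler_normB _ _)).
apply: (le_trans (lerD (sum_le _) (sum_le _))).
rewrite -mulrDl -natrD /fset_symdiff cardfsU.
have -> : ((A `\` B) `&` (B `\` A) = fset0)%fset.
  by apply/fsetP => s; rewrite !inE; case: (s \in A); rewrite ?andbF.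
by rewrite cardfs0 subn0.
Qed.

(** On the coset of [x] both sides read [pi (x * s^-1) v], so this is a change of index along
    [coset_act H s]. *)
Lemma sum_rep_coset_act H L A s v :
  [set` L] `<=` normalizer H -> [set` A] `<=` lcosets H L -> s \in L ->
  fixed_vectors pi H v ->
  \sum_(t <- A) rep_coset pi t (pi s^-1%g v)
  = \sum_(t <- (coset_act H s @` A)%fset) rep_coset pi t v.
Proof.
move=> LN AL sL vH; have sVL : s^-1%g \in L by exact: gpredVr.
rewrite big_imfset /=; last first.
  (* Injectivity of the reindexing: the action of [s^-1] undoes that of [s]. *)
  move=> t t' /AL[x _ <-] /AL[x' _ <-] /(congr1 (coset_act H s^-1%g)).
  by rewrite !coset_actE ?invgK ?mulgVK//; exact: LN.
apply: eq_big_seq => t /AL[x _ <-].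
rewrite coset_actE; last exact: LN.
by rewrite !rep_cosetE// ?rep_opM//; apply: fixed_vectors_normalizer => //; exact: LN.
Qed.

(** Averaging [pi s v] over [F n] amounts to summing [v] over the translate of [F n] by [s^-1], so
    the two means differ by at most the Folner ratio of [s^-1] times the norm of [v]. *)
Lemma coset_mean_coboundary H L (F : nat -> {fset set G}) s v :
  [set` L] `<=` normalizer H -> right_folner R H L F -> s \in L ->
  fixed_vectors pi H v ->
  (fun n => coset_mean (F n) (pi s v - v)) @ \oo --> (0 : V).
Proof.
move=> LN [F0 FL Fs] sL vH; have sVL : s^-1%g \in L by exact: gpredVr.
apply/cvgrPdist_lt => e e0.
have v1 : 0 < `|v| + 1 by rewrite ltr_wpDl.
have d0 : 0 < e / (`|v| + 1) by rewrite divr_gt0.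
have dE : (complex.Re (e / (`|v| + 1)))%:C%C = e / (`|v| + 1).
  by rewrite RRe_real// gtr0_real.
have rd0 : 0 < complex.Re (e / (`|v| + 1)) by rewrite -ltcR dE.
(* The Folner ratios converge in [R], so the tolerance enters through its real part. *)
have := Fs _ sVL => /cvgrPdist_lt/(_ _ rd0); apply: filterS => n.
rewrite !sub0r !normrN ger0_norm ?divr_ge0// -ltcR dE rmorphM /= fmorphV !rmorph_nat => lt_n.
rewrite coset_meanB /coset_mean -{1}(invgK s).
rewrite (sum_rep_coset_act LN (FL n) sVL vH) -scalerBr normrZ normfV normr_nat distrC.
apply: (@le_lt_trans _ _ (#|` F n|%:R^-1 *
  (#|` fset_symdiff (F n) (coset_act H s^-1%g @` F n)%fset|%:R * `|v|))).
  rewrite ler_wpM2l// sum_fset_symdiff// => t.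
  by rewrite rep_norm.
rewrite mulrA (mulrC _^-1).
apply: (@le_lt_trans _ _ (e / (`|v| + 1) * `|v|)); first by rewrite ler_wpM2r// ltW.
by rewrite -mulrA gtr_pMr// ltr_pdivrMl// mulr1 ltrDl.
Qed.

(** The subspace [N] of the proof idea. *)
Definition null_vectors H (F : nat -> {fset set G}) : set V :=
  [set w | fixed_vectors pi H w /\ (fun n => coset_mean (F n) w) @ \oo --> (0 : V)].

Lemma null_vectors0 H F : null_vectors H F 0.
Proof.
split=> [g _|]; first by rewrite linear0.
under eq_fun do rewrite -(subrr 0) coset_meanB subrr.
exact: cvg_cst.
Qed.

Lemma null_vectors_lin H F a u w :
  null_vectors H F u -> null_vectors H F w -> null_vectors H F (a *: u + w).
Proof.
move=> [uH u0] [wH w0]; split; first exact: fixed_vectors_lin.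
under eq_fun do rewrite coset_mean_lin.
rewrite -[0 : V](addr0 0) -{1}(scaler0 _ a).
by apply: cvgD => //; exact: cvgZl_tmp.
Qed.

(** If [w] in [N] is close to [p], the mean of [p] is the mean of [w], which tends to 0, plus that
    of [p - w], which is small by contraction. *)
Lemma closed_null_vectors H F : closed (null_vectors H F).
Proof.
move=> p cp; split.
  apply: closed_fixed_vectors; by apply: closureS cp => w [].
apply/cvgrPdist_lt => e e0; have e20 : 0 < e / 2 by rewrite divr_gt0.
have [w [_ /cvgrPdist_lt/(_ _ e20) w0] pw] := closure_dist cp e20.
apply: filterS w0 => n; rewrite !sub0r !normrN => w0.
rewrite -(subrK w p) -[_ - _]scale1r coset_mean_lin scale1r.
rewrite (le_lt_trans (ler_normD _ _))// [ltRHS]splitr ltrD//.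
exact: le_lt_trans (coset_mean_norm _ _) pw.
Qed.

(** Orthogonality to [pi s p - p] gives equality in Cauchy-Schwarz for [p] and [pi s p], which have
    equal norms; expanding the squared norm of [pi s p - p] yields 0. *)
Lemma orth_null_vectors_fixed H L (F : nat -> {fset set G}) p :
  {subset H <= L} -> [set` L] `<=` normalizer H -> right_folner R H L F ->
  fixed_vectors pi H p -> (forall w, null_vectors H F w -> hdot p w = 0) ->
  fixed_vectors pi L p.
Proof.
move=> HL LN Ff pH orth s sL.
have psp : hdot p (pi s p) = `|p| ^+ 2.
  apply/eqP; rewrite -subr_eq0 -hdot_norm -linearBr; apply/eqP/orth; split.
    by apply: fixed_vectorsB => //; apply: fixed_vectors_normalizer => //; exact: LN.
  exact: coset_mean_coboundary LN Ff sL pH.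
have ppsp : hdot (pi s p) p = `|p| ^+ 2 by rewrite hdotC psp geC0_conj ?exprn_ge0.
apply/eqP; rewrite -subr_eq0 -normr_eq0 -sqrf_eq0 -hdot_norm dnormB.
rewrite ppsp !hdot_norm rep_norm geC0_conj ?exprn_ge0//.
by rewrite subrr.
Qed.

(** For every [n] the pairing equals that of the mean of [q] with [w], which tends to 0 by
    Cauchy-Schwarz. *)
Lemma null_vectors_orth H L (F : nat -> {fset set G}) q w :
  right_folner R H L F -> null_vectors H F q -> fixed_vectors pi L w ->
  hdot q w = 0.
Proof.
move=> [F0 FL _] [qH q0] wL.
apply/eqP; rewrite -normr_eq0 eq_le normr_ge0 andbT; apply/ler_addgt0Pr => e e0.
rewrite add0r.
have w1 : 0 < `|w| + 1 by rewrite ltr_wpDl.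
have d0 : 0 < e / (`|w| + 1) by rewrite divr_gt0.
move/cvgrPdist_lt: q0 => /(_ _ d0)/filter_ex[n /=].
rewrite sub0r normrN => lt_n.
rewrite -(coset_mean_dot (F0 n) (FL n) qH wL) (le_trans (hdot_le _ _))//.
apply: (@le_trans _ _ (e / (`|w| + 1) * `|w|)); first by rewrite ler_wpM2r// ltW.
by rewrite -mulrA ger_pMr// ler_pdivrMl// mulr1 lerDl.
Qed.

End UnitaryRepresentation.

(** * Convergence of the averages to the projection *)

Theorem theorem1p2 (R : realType) (G : groupType) (H L : groupClosed G)
    (F : nat -> {fset set G}) :
  countable [set: G] ->
  {subset H <= L} ->
  [set` L] `<=` normalizer H ->
  right_amenable R H L ->
  right_folner R H L F ->
  strong_sequence R H L F.
Proof.
move=> _ HL LN _ Ff V pi v vH; have [F0 FL _] := Ff.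
have [q [qH q0] orth] := hilbert_projection v (null_vectors0 pi H F)
  (@null_vectors_lin _ _ _ pi H F) (@closed_null_vectors _ _ _ pi H F).
have pL : fixed_vectors pi L (v - q).
  by apply: (orth_null_vectors_fixed HL LN Ff) => //; exact: fixed_vectorsB.
have -> : orth_proj (fixed_vectors pi L) v = v - q.
  apply: orth_proj_eq => // [x y|w wL]; first exact: fixed_vectorsB.
  by rewrite opprB addrC subrK; exact: null_vectors_orth Ff (conj qH q0) wL.
rewrite -[v - q]add0r.
(* The [L]-fixed part [v - q] equals its own mean, so only the mean of [q] varies with [n]. *)
have -> : (fun n => (#|` F n|%:R : R[i])^-1 *: \sum_(s <- F n) rep_coset pi s v)
    = (fun n => coset_mean pi (F n) q + (v - q)).
  apply/funext => n.
  by rewrite -(coset_mean_fixed (F0 n) (FL n) HL pL) coset_meanB addrC subrK.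
apply: cvgD => //; exact: cvg_cst.
Qed.
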